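(* Let $k \in \mathbb{N}$, let $M \in \mathbf{J}_k$ and let $\Sigma$ be an alphabet. Then there exists a constant $c \in \mathbb{N}_{>0}$ such that, for every $n \in \mathbb{N}$, any program over $M$ on $\Sigma^n$ is equivalent to a program over $M$ on $\Sigma^n$ of length at most $c \cdot n^{\lceil k/2 \rceil}$. In particular, $\mathcal{P}(\mathbf{J}_k) = \mathcal{P}(\mathbf{J}_k, n^{\lceil k/2 \rceil})$ for all $k \in \mathbb{N}$.
   Context: $\mathbb{N}$ includes $0$; $[n] = \{1, \ldots, n\}$; all alphabets are finite; $n^0 = 1$ for all $n$. Varieties. A variety of monoids is a class of finite monoids closed under submonoids, (finite) Cartesian products and morphic images. A word $u = u_1 \cdots u_m$ is a subword of $w$ if it is a (not necessarily contiguous) subsequence of $w$. For an alphabet $\Sigma$ and $k \in \mathbb{N}$, $\sim_k$ is the congruence on $\Sigma^*$ defined by $u \sim_k v$ iff $u$ and $v$ have the same set of subwords of length at most $k$. $\mathbf{J}_k$ is the inclusion-wise smallest variety of monoids containing all quotients $\Sigma^* / {\sim_k}$ for all alphabets $\Sigma$. Programs. Let $M$ be a finite monoid, $\Sigma$ an alphabet and $n \in \mathbb{N}$. A program $P$ over $M$ on $\Sigma^n$ is a finite sequence of instructions $(i, f)$ with $i \in [n]$ and $f \colon \Sigma \to M$; its length $|P|$ is its number of instructions. On input $w \in \Sigma^n$, instruction $(i, f)$ outputs $f(w_i)$, and $P(w) \in M$ is the product, in order, of the outputs of the instructions. $P$ recognises $L \subseteq \Sigma^n$ if $L = P^{-1}(F)$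 for some $F \subseteq M$. Two programs over the same monoid on the same $\Sigma^n$ are equivalent if they recognise the same languages. A language $L \subseteq \Sigma^*$ is recognised by a sequence $(P_n)_{n \in \mathbb{N}}$ of programs over one fixed finite monoid $M$ if for each $n$, $P_n$ is a program over $M$ on $\Sigma^n$ recognising $L \cap \Sigma^n$. For a variety of monoids $\mathbf{V}$ and $s \colon \mathbb{N} \to \mathbb{N}$, $\mathcal{P}(\mathbf{V}, s(n))$ is the class of languages (over arbitrary finite alphabets) recognised by some sequence $(P_n)_{n \in \mathbb{N}}$ of programs over some monoid in $\mathbf{V}$ for which there is a real $\alpha > 0$ with $|P_n| \leq \alpha \cdot s(n)$ for all $n \in \mathbb{N}$; and $\mathcal{P}(\mathbf{V}) = \bigcup_{j \in \mathbb{N}} \mathcal{P}(\mathbf{V}, n^j)$. *)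

(* Defs.v *)
From HB Require Import structures.
From mathcomp Require Import all_boot generic_quotient.
From mathcomp Require Import ssralg ssrnum.
From mathcomp Require Import boolp classical_sets reals.

Set Implicit Arguments.
Unset Strict Implicit.
Unset Printing Implicit Defensive.

(* The multiplicative monoids of monoid.v whose carrier is finite. *)
#[short(type="finMonoidType")]
HB.structure Definition FinMonoid := {M of Monoid M & Finite M}.

(* monoid.v has pointwise products of copies of one monoid and binary products
   only; this is the product of an arbitrary finite family. *)
Section FiniteProduct.
Variables (I : finType) (M : I -> finMonoidType).
Local Notation prodM := {dffun forall i, M i}.

Definition dffun_one : prodM := [ffun=> 1%g].
Definition dffun_mul (x y : prodM) : prodM := [ffun i => (x i * y i)%g].

Lemma dffun_mulA : associative dffun_mul.
Proof. by move=> x y z; apply/ffunP => i; rewrite !ffunE mulgA. Qed.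

Lemma dffun_mul1 : left_id dffun_one dffun_mul.
Proof. by move=> x; apply/ffunP => i; rewrite !ffunE mul1g. Qed.

Lemma dffun_1mul : right_id dffun_one dffun_mul.
Proof. by move=> x; apply/ffunP => i; rewrite !ffunE mulg1. Qed.

HB.instance Definition _ :=
  isMonoid.Build prodM dffun_mulA dffun_mul1 dffun_1mul.

End FiniteProduct.

(* A submonoid of M is given up to isomorphism, as the domain of an injective
   morphism into M. Taking I empty in variety_prod yields the trivial monoid, so
   a variety is never empty. *)
Record variety (V : finMonoidType -> Prop) : Prop := Variety {
  variety_sub : forall (M N : finMonoidType) (f : N -> M),
    monoid_morphism f -> injective f -> V M -> V N;
  variety_prod : forall (I : finType) (M : I -> finMonoidType),
    (forall i, V (M i)) -> V {dffun forall i, M i};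
  variety_image : forall (M N : finMonoidType) (f : M -> N),
    monoid_morphism f -> (forall y, exists x, f x = y) -> V M -> V N }.

Section SubwordCongruence.
Variables (k : nat) (Sigma : finType).
Implicit Types u v w x : seq Sigma.

Definition subwords w : {set k.-bseq Sigma} :=
  [set x : k.-bseq Sigma | subseq x w].

Definition simk u v : bool := subwords u == subwords v.

Lemma simk_refl : reflexive simk.
Proof. by move=> u; apply: eqxx. Qed.

Lemma simk_sym : symmetric simk.
Proof. by move=> u v; apply: eq_sym. Qed.

Lemma simk_trans : transitive simk.
Proof. by move=> v u w /eqP uv /eqP vw; rewrite /simk uv vw. Qed.

Canonical simk_equiv := EquivRel simk simk_refl simk_sym simk_trans.

Lemma simkP u v :
  reflect (forall x, size x <= k -> subseq x u = subseq x v) (simk u v).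
Proof.
apply: (iffP eqP) => [E x kx | E]; last first.
  by apply/setP => x; rewrite !inE E ?size_bseq.
by have /setP/(_ (Bseq kx)) := E; rewrite !inE.
Qed.

Lemma subseq_catP x u v :
  reflect (exists x1 x2, [/\ x = x1 ++ x2, subseq x1 u & subseq x2 v])
          (subseq x (u ++ v)).
Proof.
apply: (iffP idP) => [/subseqP[m sm ->] | [x1 [x2 [-> x1u x2v]]]]; last first.
  exact: cat_subseq.
have su : size (take (size u) m) = size u.
  by rewrite size_takel // sm size_cat leq_addr.
exists (mask (take (size u) m) u), (mask (drop (size u) m) v).
by rewrite !mask_subseq -mask_cat // cat_take_drop.
Qed.

Lemma simk_cat u u' v v' : simk u u' -> simk v v' -> simk (u ++ v) (u' ++ v').
Proof.
move=> /simkP Eu /simkP Ev; apply/simkP => x kx.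
apply/subseq_catP/subseq_catP => -[x1 [x2 [Ex x1u x2v]]]; exists x1, x2;
  move: kx; rewrite Ex size_cat => kx; split=> //.
- by rewrite -Eu // (leq_trans _ kx) // leq_addr.
- by rewrite -Ev // (leq_trans _ kx) // leq_addl.
- by rewrite Eu // (leq_trans _ kx) // leq_addr.
- by rewrite Ev // (leq_trans _ kx) // leq_addl.
Qed.

Definition simk_quot := {eq_quot simk_equiv}%qT.

HB.instance Definition _ := Choice.on simk_quot.
HB.instance Definition _ := EqQuotient.on simk_quot.

Definition simk_one : simk_quot := (\pi_simk_quot [::])%qT.
Definition simk_mul (a b : simk_quot) : simk_quot :=
  (\pi_simk_quot (repr a ++ repr b))%qT.

Lemma simk_piP u v :
  reflect (\pi_simk_quot u = \pi_simk_quot v)%qT (simk u v).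
Proof. exact: (@eqquotP _ _ simk_quot). Qed.

Lemma simk_mul_pi u v :
  simk_mul (\pi_simk_quot u)%qT (\pi_simk_quot v)%qT
  = (\pi_simk_quot (u ++ v))%qT.
Proof. by apply/simk_piP; apply: simk_cat; apply/simk_piP; rewrite reprK. Qed.

Lemma simk_mulA : associative simk_mul.
Proof.
elim/quotW=> u; elim/quotW=> v; elim/quotW=> w.
by rewrite (simk_mul_pi v) (simk_mul_pi u (v ++ w)) (simk_mul_pi u v)
  (simk_mul_pi (u ++ v)) catA.
Qed.

Lemma simk_mul1 : left_id simk_one simk_mul.
Proof. by elim/quotW=> u; rewrite simk_mul_pi. Qed.

Lemma simk_1mul : right_id simk_one simk_mul.
Proof. by elim/quotW=> u; rewrite simk_mul_pi cats0. Qed.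

HB.instance Definition _ :=
  isMonoid.Build simk_quot simk_mulA simk_mul1 simk_1mul.

(* ~_k has finite index: by the pigeonhole principle on its prefixes, every
   word is equivalent to one of length at most simk_bound. *)
Definition simk_bound := #|{set k.-bseq Sigma}|.

Lemma simk_short w : exists x : simk_bound.-bseq Sigma, simk w x.
Proof.
elim: {w}(size w) {-2}w (leqnn (size w)) => [|n IHn] w sw.
  have sw0 : size w <= simk_bound by apply: leq_trans sw _.
  by exists (Bseq sw0); apply: simk_refl.
have [sw0 | lt_w] := leqP (size w) simk_bound.
  by exists (Bseq sw0); apply: simk_refl.
pose F (i : 'I_(size w)) := subwords (take i w).
have /injectiveP/injectivePn[i [j]] : ~ injective F.
  by move/leq_card; rewrite card_ord leqNgt lt_w.
wlog lt_ij : i j / i < j.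
  move=> IH ij Fij; have := ij; rewrite -val_eqE neq_ltn => /orP[] lt.
    exact: (IH i j).
  by apply: (IH j i) => //; rewrite eq_sym.
move=> _ Fij.
have sij : simk w (take i w ++ drop j w).
  rewrite -{1}[w](cat_take_drop j); apply: simk_cat; last exact: simk_refl.
  by apply/eqP; apply/esym.
have [|x sx] := IHn (take i w ++ drop j w).
  rewrite size_cat size_takel ?size_drop; last exact: ltnW.
  rewrite -ltnS; apply: leq_trans sw.
  by rewrite -[X in _ < X](subnKC (ltnW (ltn_ord j))) ltn_add2r.
by exists x; apply: simk_trans sij sx.
Qed.

Definition simk_rep (a : simk_quot) : simk_bound.-bseq Sigma :=
  xchoose (simk_short (repr a)).

Lemma simk_repK :
  cancel simk_rep (fun x : simk_bound.-bseq Sigma => (\pi_simk_quot x)%qT).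
Proof.
move=> a; rewrite -[RHS]reprK; apply/esym/simk_piP.
exact: xchooseP (simk_short (repr a)).
Qed.

HB.instance Definition _ : isCountable simk_quot := CanIsCountable simk_repK.
HB.instance Definition _ : isFinite simk_quot := CanIsFinite simk_repK.

End SubwordCongruence.

Definition J (k : nat) (M : finMonoidType) : Prop :=
  forall V : finMonoidType -> Prop,
    variety V -> (forall Sigma : finType, V (simk_quot k Sigma)) -> V M.

(* Positions are counted from 0; an instruction (i, f) reads the letter at
   position i. *)
Definition program (M : finMonoidType) (Sigma : finType) (n : nat) :=
  seq ('I_n * {ffun Sigma -> M}).

Section Programs.
Variables (M : finMonoidType) (Sigma : finType) (n : nat).

Definition prog_eval (P : program M Sigma n) (w : n.-tuple Sigma) : M :=
  (\prod_(ins <- P) ins.2 (tnth w ins.1))%g.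

Definition prog_recognises (P : program M Sigma n) (L : set (n.-tuple Sigma)) :
  Prop := exists F : set M, L = (prog_eval P @^-1` F)%classic.

Definition prog_equiv (P Q : program M Sigma n) : Prop :=
  forall L : set (n.-tuple Sigma), prog_recognises P L <-> prog_recognises Q L.

End Programs.

Definition seq_recognises (M : finMonoidType) (Sigma : finType)
    (P : forall n, program M Sigma n) (L : set (seq Sigma)) : Prop :=
  forall n, prog_recognises (P n) [set w : n.-tuple Sigma | L w]%classic.

(* The languages over Sigma in P(V, s(n)). *)
Definition prog_class (R : realType) (V : finMonoidType -> Prop) (s : nat -> nat)
    (Sigma : finType) : set (set (seq Sigma)) :=
  [set L | exists (M : finMonoidType) (P : forall n, program M Sigma n),
     [/\ V M, seq_recognises P L &
         exists2 alpha : R, (0 < alpha)%R &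
           forall n, ((size (P n))%:R <= alpha * (s n)%:R)%R]]%classic.
Arguments prog_class : clear implicits.

Definition prog_class_poly (R : realType) (V : finMonoidType -> Prop)
    (Sigma : finType) : set (set (seq Sigma)) :=
  (\bigcup_j prog_class R V (fun n => n ^ j)%N Sigma)%classic.
Arguments prog_class_poly : clear implicits.

(* Main.v *)
Require Import Defs.
From mathcomp Require Import all_boot.
From mathcomp Require Import boolp classical_sets reals.
From mathcomp Require Import generic_quotient ssralg ssrnum.

(** A program over [M] is a word over the instructions, and evaluating it on a
    fixed input is a morphism to [M]. Such morphisms identify [~_k]-equivalent
    words when [M] is in [J k], because the monoids with this property form a
    variety containing all the quotients by [~_k]. So it suffices to shorten
    words over an alphabet of size [b] up to [~_k]. With [h = uphalf k], the
    marked letter of [x a y] can be deleted as soon as [x ~_h x a] and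
    [a y ~_h y]. Once no deletion is possible, each position makes a new
    subword of length at most [h] appear, in the prefixes read from the left or
    in the suffixes read from the right, so there are [O(b ^ h)] positions. *)

Set Implicit Arguments.
Unset Strict Implicit.
Unset Printing Implicit Defensive.

Lemma subseq_cons_inv (T : eqType) (s y : seq T) (a : T) :
  subseq s (a :: y) -> subseq s y \/ exists2 t, s = a :: t & subseq t y.
Proof.
case: s => [|b s] /=; first by left; rewrite sub0seq.
by case: eqP => [-> sy | _ bsy]; [right; exists s | left].
Qed.

(** Keep only the letters of [u] whose blocks contribute a nonempty piece of [x]: each accounts for
    at least one letter of [x]. *)
Lemma subseq_flatten_map (T : eqType) (S : finType) (g : T -> seq S) x u :
  subseq x (flatten (map g u)) ->
  exists u', [/\ subseq u' u, size u' <= size x & subseq x (flatten (map g u'))].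
Proof.
elim: u x => [|a u IHu] x /=; first by move=> sx; exists [::].
case/subseq_catP => x1 [x2 [-> s1 /IHu[u' [su' zu' sx2]]]].
case: x1 s1 => [|b x1] s1.
  exists u'; split=> //; exact: subseq_trans su' (subseq_cons _ _).
exists (a :: u'); split; first by rewrite /= eqxx.
  by rewrite /= ltnS size_cat (leq_trans zu') ?leq_addl.
exact: (cat_subseq s1 sx2).
Qed.

Lemma flatten_map_subseq (T S : eqType) (g : T -> seq S) u v :
  subseq u v -> subseq (flatten (map g u)) (flatten (map g v)).
Proof.
elim: v u => [|a v IHv] u; first by case: u.
case/subseq_cons_inv => [/IHv su | [t -> /IHv st]] /=.
  exact: subseq_trans su (suffix_subseq _ _).
exact: cat_subseq.
Qed.

Lemma simk_flatten_map k (B S : finType) (g : B -> seq S) u v :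
  simk k u v -> simk k (flatten (map g u)) (flatten (map g v)).
Proof.
suff sub u' v' x : simk k u' v' -> size x <= k ->
    subseq x (flatten (map g u')) -> subseq x (flatten (map g v')).
  move=> uv; apply/simkP => x kx; apply/idP/idP; first exact: sub uv kx.
  by apply: sub kx; rewrite simk_sym.
move=> /simkP Euv kx /subseq_flatten_map[t [tu tx xt]].
apply: subseq_trans xt (flatten_map_subseq _ _).
by rewrite -Euv // (leq_trans tx).
Qed.

(** Every morphism from a finitely generated free monoid to [M] factors through [~_k]. *)
Definition word_invariant k (M : finMonoidType) :=
  forall (B : finType) (phi : B -> M) (u v : seq B),
    simk k u v -> (\prod_(a <- u) phi a = \prod_(a <- v) phi a)%g.

Lemma word_invariant_variety k : variety (word_invariant k).
Proof.
split=> [M N f [f1 fM] injf VM B phi u v uv | I M VM B phi u v uv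
        | M N f [f1 fM] surjf VM B phi u v uv].
- by apply: injf; rewrite !(big_morph f fM f1); apply: VM.
- apply/ffunP => i.
  pose p (x : {dffun forall i, M i}) := x i.
  have p1 : p 1%g = 1%g by rewrite /p ffunE.
  have pM : {morph p : x y / (x * y)%g} by move=> x y; rewrite /p ffunE.
  rewrite -[LHS]/(p _) -[RHS]/(p _) !(big_morph p pM p1).
  exact: (VM i).
(* Lift the value of each letter along the surjection [f]; products lift with them. *)
- have [psi psiP] := choice (fun a => surjf (phi a)).
  rewrite -!(eq_bigr _ (fun a _ => psiP a)) -!(big_morph f fM f1).
  by rewrite (VM _ psi _ _ uv).
Qed.

Lemma word_invariant_quot k (S : finType) : word_invariant k (simk_quot k S).
Proof.
move=> B phi u v uv.
(* A product in the quotient is the class of a word obtained by substitution, and substitution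
   preserves [~_k]. *)
have prod_pi (w : seq B) : (\prod_(a <- w) phi a)%g
    = (\pi_(simk_quot k S) (flatten [seq repr (phi a) | a <- w]))%qT.
  elim: w => [|a w IHw]; first by rewrite big_nil.
  rewrite big_cons IHw /= -[X in (X * _)%g]reprK; exact: simk_mul_pi.
rewrite !prod_pi; apply/simk_piP; exact: simk_flatten_map.
Qed.

Lemma J_word_invariant k (M : finMonoidType) : J k M -> word_invariant k M.
Proof. apply; [exact: word_invariant_variety | exact: word_invariant_quot]. Qed.

(** Split a short subword of [x a y] as [s1 s2]. If [s2] has length at most [l], it fits in [y]. If
    it is longer and uses the marked letter, [s2 = a t], then [s1 a] has length at most [r] and fits
    in [x]. *)
Lemma simk_delete (B : finType) r l k x a (y : seq B) : k <= r + l ->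
  simk r x (rcons x a) -> simk l (a :: y) y -> simk k (x ++ a :: y) (x ++ y).
Proof.
move=> krl /simkP Ex /simkP Ey; apply/simkP => s ks.
apply/idP/idP => [|sxy]; last first.
  by apply: subseq_trans sxy _; apply: cat_subseq; last exact: subseq_cons.
case/subseq_catP => s1 [s2 [Es s1x s2y]]; rewrite Es size_cat in ks *.
have [s2l | ls2] := leqP (size s2) l; first by rewrite cat_subseq -?Ey.
case/subseq_cons_inv: s2y => [s2y | [t Et ty]]; first exact: cat_subseq.
rewrite Et -cat_rcons; apply: cat_subseq => //; rewrite Ex.
  by rewrite -!cats1; apply: cat_subseq.
rewrite size_rcons -(leq_add2r l) (leq_trans _ krl) // (leq_trans _ ks) //.
by rewrite addSnnS leq_add2l.
Qed.

Lemma simk_reduce (B : finType) h k (w : seq B) : k <= h + h ->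
  exists2 w', simk k w w' & forall x a y, w' = x ++ a :: y ->
    ~~ simk h x (rcons x a) || ~~ simk h (a :: y) y.
Proof.
move=> kh; elim: {w}(size w) {-2}w (leqnn (size w)) => [|n IHn] w sw.
  exists w; first exact: simk_refl.
  by move=> x a y E; move: sw; rewrite E size_cat addnS.
have [red | irr] := pselect (exists x a y,
    [/\ w = x ++ a :: y, simk h x (rcons x a) & simk h (a :: y) y]); last first.
  exists w => [|x a y E]; first exact: simk_refl.
  by rewrite -negb_and; apply/negP => /andP[sx sy]; apply: irr; exists x, a, y.
have [x [a [y [E sx sy]]]] := red.
have [|w' sw' irr] := IHn (x ++ y).
  by move: sw; rewrite E !size_cat addnS ltnS.
exists w'; last exact: irr.
by apply: simk_trans sw'; rewrite E; apply: simk_delete kh sx sy.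
Qed.

(** Each strict inclusion in the chain adds at least one element. *)
Lemma card_increasing (T : finType) (f : nat -> {set T}) n :
  (forall i, f i \subset f i.+1) ->
  \sum_(i < n) (f i != f i.+1) + #|f 0| <= #|f n|.
Proof.
move=> fS; elim: n => [|n IHn]; first by rewrite big_ord0.
rewrite big_ord_recr /= addnAC.
have [<- | neq] := eqVneq (f n) (f n.+1); first by rewrite addn0.
by rewrite addn1 (leq_ltn_trans IHn) ?proper_card // finset.properEneq neq fS.
Qed.

Lemma card_decreasing (T : finType) (f : nat -> {set T}) n :
  (forall i, f i.+1 \subset f i) ->
  \sum_(i < n) (f i != f i.+1) + #|f n| <= #|f 0|.
Proof.
move=> fS; elim: n => [|n IHn]; first by rewrite big_ord0.
rewrite big_ord_recr /= (leq_trans _ IHn) // -addnA leq_add2l.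
have [<- | neq] := eqVneq (f n) (f n.+1); first by rewrite add0n.
by rewrite add1n proper_card // finset.properEneq eq_sym neq fS.
Qed.

Lemma subwords_subseq (B : finType) h (u v : seq B) :
  subseq u v -> subwords h u \subset subwords h v.
Proof.
by move=> uv; apply/fintype.subsetP => x; rewrite !inE => xu; apply: subseq_trans uv.
Qed.

Lemma card_subwords_nil (B : finType) h : #|subwords h ([::] : seq B)| = 1.
Proof.
have -> : subwords h [::] = [set [bseq] : h.-bseq B]%SET.
  by apply/setP => x; rewrite !inE subseq0.
exact: cards1.
Qed.

(* Every nonempty word of length at most [h] is a prefix of one of length [h];
   the empty word accounts for the successor. *)
Lemma card_bseq_le (B : finType) h (A : {set h.-bseq B}) :
  #|A| <= (h * #|B| ^ h).+1.
Proof.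
rewrite -[h in h * _]card_ord -card_tuple -card_prod -card_option.
pose F (p : option ('I_h * h.-tuple B)) : seq B :=
  if p is Some (i, t) then take i.+1 t else [::].
rewrite (cardE A) -(size_map val) cardE -(size_map F).
apply: uniq_leq_size; first by rewrite (map_inj_uniq val_inj) enum_uniq.
move=> _ /mapP[[[|b x] /= xh] _ ->]; apply/mapP.
  by exists None; rewrite ?mem_enum.
(* Padding repeats the first letter of the word itself, so no default letter of [B] is called
   for. *)
have th : size ((b :: x) ++ nseq (h - size (b :: x)) b) == h.
  by rewrite size_cat size_nseq subnKC.
exists (Some (Ordinal xh, Tuple th)); rewrite ?mem_enum //=.
by rewrite take_size_cat.
Qed.

Lemma size_irreducible (B : finType) h (w : seq B) :
  (forall x a y, w = x ++ a :: y ->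
    ~~ simk h x (rcons x a) || ~~ simk h (a :: y) y) ->
  size w <= 2 * (h * #|B| ^ h).
Proof.
move=> irr.
pose f i := subwords h (take i w); pose g i := subwords h (drop i w).
have fS i : f i \subset f i.+1.
  by apply: subwords_subseq; rewrite -(take_takel w (leqnSn i)) take_subseq.
have gS i : g i.+1 \subset g i.
  by apply: subwords_subseq; rewrite -add1n -drop_drop drop_subseq.
have := leq_add (card_increasing (size w) fS) (card_decreasing (size w) gS).
rewrite /f /g take0 take_size drop0 drop_size card_subwords_nil.
rewrite addnACA -big_split /= => le_w.
(* [f 0] and [g (size w)] contain only the empty word. These two units later cancel the successor in
   [card_bseq_le], doubled, so that no additive constant remains. *)
have {le_w}: size w + 2 <= 2 * #|subwords h w|.
  rewrite mul2n -addnn; apply: leq_trans le_w; rewrite leq_add2r.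
  rewrite -{1}[size w]card_ord -sum1_card; apply: leq_sum => i _.
  (* The first letter of a nonempty [w] serves as the default of [nth]; an empty [w] has no
     positions. *)
  case: w irr i {f g fS gS} => [|b w] irr; first by case.
  set u := b :: w in irr * => i.
  have := irr (take i u) (nth b u i) (drop i.+1 u).
  rewrite -take_nth // -drop_nth // cat_take_drop => /(_ erefl).
  by rewrite /simk; case: (_ == _) => //=; case: (_ == _).
have := card_bseq_le (subwords h w); rewrite -(leq_pmul2l (isT : 0 < 2)) => le.
by move/leq_trans => /(_ _ le); rewrite mulnS addnC leq_add2l.
Qed.

Lemma short_program k (M : finMonoidType) (Sigma : finType) : J k M ->
  exists c : nat, (0 < c)%N /\
    forall (n : nat) (P : program M Sigma n),
      exists Q : program M Sigma n,
        prog_equiv P Q /\ (size Q <= c * n ^ uphalf k)%N.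
Proof.
move=> JM; set h := uphalf k.
(* The alphabet of instructions has [n * #|{ffun Sigma -> M}|] letters, and [n ^ h] factors out of
   its [h]-th power; the successor makes the constant positive. *)
exists (2 * (h * #|{ffun Sigma -> M}| ^ h)).+1; split=> // n P.
have kh : k <= h + h.
  rewrite addnn -{1}(odd_double_half k) /h uphalf_half doubleD leq_add2r.
  by case: (odd k).
have [Q PQ irr] := simk_reduce P kh.
exists Q; split.
  (* For fixed [w], the map [phi] sends an instruction to its output on [w]. *)
  have E : prog_eval P = prog_eval Q.
    by apply/funext => w; apply: J_word_invariant JM _ _ _ _ PQ.
  by move=> L; rewrite /prog_recognises E.
apply: leq_trans (size_irreducible irr) _.
by rewrite card_prod card_ord expnMn (mulnC (n ^ h)) 2!mulnA leq_mul // -mulnA.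
Qed.

Theorem proposition3p4 (R : realType) :
  (forall (k : nat) (M : finMonoidType) (Sigma : finType), J k M ->
     exists c : nat, (0 < c)%N /\
       forall (n : nat) (P : program M Sigma n),
         exists Q : program M Sigma n,
           prog_equiv P Q /\ (size Q <= c * n ^ uphalf k)%N) /\
  (forall (k : nat) (Sigma : finType),
     prog_class_poly R (J k) Sigma =
     prog_class R (J k) (fun n => (n ^ uphalf k)%N) Sigma).
Proof.
split=> [k M Sigma | k Sigma]; first exact: short_program.
apply/seteqP; split=> L; last by exists (uphalf k).
case=> j _ [M [P [JM PL _]]].
have [c [c0 cP]] := short_program Sigma JM.
(* Choose one shortened program for each [n], all over the same [M] and with the same [c]. *)
pose QP n := svalP (cid (cP n (P n))).
exists M, (fun n => sval (cid (cP n (P n)))); split=> //.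
  by move=> n; apply/(proj1 (QP n)); apply: PL.
exists (c%:R)%R; first by rewrite Num.Theory.ltr0n.
by move=> n; rewrite -GRing.natrM Num.Theory.ler_nat; case: (QP n).
Qed.
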